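(* Let $k$ be a field and let $H$ be a Hopf algebra over $k$ with bijective antipode. Let $N\ge1$ and let $\pi_i : P \rightarrow P_i$, $i=1,\ldots,N$, be surjective homomorphisms of right $H$-comodule algebras. Assume that $P$ is principal. Then $\{\pi_i : P \rightarrow P_i\}_{i}$ is a covering of $P$ if and only if $\{\pi_i^{\mathrm{co}H} : P^{\mathrm{co}H} \rightarrow P_i^{\mathrm{co}H}\}_i$ is a covering of $P^{\mathrm{co}H}$.
   Context: All algebras, coalgebras, etc. are over a field $k$, and $\otimes=\otimes_k$. Let $(H,\Delta,\varepsilon,S)$ be a Hopf algebra with bijective antipode. A right $H$-comodule algebra $P$ is a unital associative algebra equipped with a right $H$-coaction $\Delta_P:P\to P\otimes H$, $p\mapsto p_{(0)}\otimes p_{(1)}$, that is an algebra map. Homomorphisms of right $H$-comodule algebras are unital algebra homomorphisms which are right $H$-colinear. The coaction-invariant subalgebra is $P^{\mathrm{co}H}:=\{p\in P\mid \Delta_P(p)=p\otimes 1\}$; a homomorphism $\pi_i:P\to P_i$ of comodule algebras restricts to an algebra homomorphism $\pi_i^{\mathrm{co}H}:P^{\mathrm{co}H}\to P_i^{\mathrm{co}H}$. With $B:=P^{\mathrm{co}H}$, the comodule algebra $P$ is called principal if: (1) the canonical map $P\otimes_B P\to P\otimes H$, $p\otimes q\mapsto pq_{(0)}\otimes q_{(1)}$, is bijective; and (2) there exists a right $H$-colinear and left $B$-linear splitting $P\to B\otimes P$ of the multiplication map $B\otimes P\to P$ (where $H$ coacts on $B\otimes P$ via $\mathrm{id}_B\otimes\Delta_P$).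 A finite family $\pi_i:A\to A_i$, $i=1,\ldots,N$, of surjective algebra homomorphisms is called a covering of the algebra $A$ if $\bigcap_{i=1}^N\ker\pi_i=\{0\}$ and the lattice of ideals of $A$ generated by $\ker\pi_1,\ldots,\ker\pi_N$ (with lattice operations $+$ and $\cap$) is distributive. *)

(* Defs.v *)
From HB Require Import structures.
From mathcomp Require Import all_boot all_algebra.
From mathcomp Require Import boolp classical_sets.
From mathcomp Require Import freeg.

Set Implicit Arguments.
Unset Strict Implicit.
Unset Printing Implicit Defensive.

Import GRing.Theory.
Local Open Scope ring_scope.
Local Open Scope quotient_scope.
Local Open Scope classical_set_scope.

Reserved Notation "V ** W" (at level 40, left associativity).
Reserved Notation "v *t w" (at level 40, left associativity).

Section Span.
Variables (k : fieldType) (V : lmodType k) (G : set V).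

Inductive mspan : V -> Prop :=
| mspan0 : mspan 0
| mspan_comb (a : k) (g v : V) : G g -> mspan v -> mspan (a *: g + v).

Lemma mspanD u v : mspan u -> mspan v -> mspan (u + v).
Proof.
by elim=> [|a g w Gg _ IH] Sv; rewrite ?add0r // -addrA; apply: mspan_comb => //; apply: IH.
Qed.

Lemma mspanZ a v : mspan v -> mspan (a *: v).
Proof.
elim=> [|b g w Gg _ IH]; first by rewrite scaler0; apply: mspan0.
by rewrite scalerDr scalerA; apply: mspan_comb.
Qed.

Lemma mspan_gen g : G g -> mspan g.
Proof. by move=> Gg; rewrite -[g]addr0 -[g]scale1r; apply/mspan_comb/mspan0. Qed.

Definition mspanb : {pred V} := fun v => `[< mspan v >].

Lemma mspanb_submod : submod_closed mspanb.
Proof.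
split; first exact/asboolP/mspan0.
by move=> a u v /asboolP Su /asboolP Sv; apply/asboolP/mspanD => //; apply: mspanZ.
Qed.

HB.instance Definition _ := GRing.isSubmodClosed.Build k V mspanb mspanb_submod.

Definition lquot : Type := Quotient.quot mspanb.

HB.instance Definition _ := Quotient.on lquot.
HB.instance Definition _ := Choice.on lquot.
HB.instance Definition _ := GRing.Zmodule.on lquot.

Definition lpi (v : V) : lquot := \pi_lquot v.

Lemma lpiK q : lpi (repr q) = q. Proof. exact: reprK. Qed.

Lemma lpi_eq u v : lpi u = lpi v <-> mspan (u - v).
Proof.
rewrite /lpi; split=> [/eqP|/asboolP Suv].
  by rewrite -Quotient.idealrBE => /asboolP.
by apply/eqP; rewrite -Quotient.idealrBE.
Qed.

Lemma lpiD : {morph lpi : u v / u + v}.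
Proof. by move=> u v; rewrite /lpi [LHS](@Quotient.pi_add _ (mspanb : zmodClosed V)). Qed.

Lemma mspan_repr v : mspan (repr (lpi v) - v).
Proof. by apply/lpi_eq; rewrite lpiK. Qed.

Definition lquot_scale (a : k) (q : lquot) : lquot := lpi (a *: repr q).

Lemma lpiZ a v : lpi (a *: v) = lquot_scale a (lpi v).
Proof.
by apply/esym/lpi_eq; rewrite -scalerBr; apply/mspanZ/mspan_repr.
Qed.

Lemma lquot_scaleA a b q :
  lquot_scale a (lquot_scale b q) = lquot_scale (a * b) q.
Proof. by rewrite -[q]lpiK -!lpiZ scalerA. Qed.

Lemma lquot_scale1 : left_id 1 lquot_scale.
Proof. by move=> q; rewrite -[q]lpiK -lpiZ scale1r. Qed.

Lemma lquot_scaleDr : right_distributive lquot_scale +%R.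
Proof.
by move=> a p q; rewrite -[p]lpiK -[q]lpiK -lpiD -!lpiZ scalerDr lpiD.
Qed.

Lemma lquot_scaleDl q : {morph lquot_scale^~ q : a b / a + b}.
Proof. by move=> a b; rewrite -[q]lpiK -!lpiZ scalerDl lpiD. Qed.

HB.instance Definition _ := GRing.Zmodule_isLmodule.Build k lquot
  lquot_scaleA lquot_scale1 lquot_scaleDr lquot_scaleDl.

Lemma lpi_linear : linear lpi.
Proof. by move=> a u v; rewrite lpiD lpiZ. Qed.

HB.instance Definition _ := GRing.isLinear.Build k V lquot *:%R lpi lpi_linear.

Lemma lpi_scale a v : lpi (a *: v) = a *: lpi v. Proof. exact: linearZ. Qed.

Lemma lpi_gen g : G g -> lpi g = 0.
Proof. by move=> Gg; rewrite -[RHS](linear0 lpi); apply/lpi_eq; rewrite subr0; apply: mspan_gen. Qed.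

Section Lift.
Variables (W : lmodType k) (f : {linear V -> W}).
Hypothesis fG : forall g, G g -> f g = 0.

Definition lquot_lift of (forall g, G g -> f g = 0) :=
  fun q : lquot => f (repr q).

Lemma lquot_lift_pi v : lquot_lift fG (lpi v) = f v.
Proof.
have f0 u : mspan u -> f u = 0.
  elim=> [|a g w Gg _ IH]; first by rewrite linear0.
  by rewrite linearP fG // IH scaler0 addr0.
by apply/eqP; rewrite -subr_eq0 -linearB f0 //; apply: mspan_repr.
Qed.

Lemma lquot_lift_linear : linear (lquot_lift fG).
Proof.
move=> a p q; rewrite -[p]lpiK -[q]lpiK -(linearP lpi).
by rewrite !lquot_lift_pi linearP.
Qed.

HB.instance Definition _ :=
  GRing.isLinear.Build k lquot W *:%R (lquot_lift fG) lquot_lift_linear.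

End Lift.
End Span.

Section FreeLift.
Variables (k : fieldType) (X : choiceType) (M : lmodType k) (f : X -> M).

Lemma fglift_linear : linear (fglift f : {freeg X / k} -> M).
Proof.
pose F : {freeg X / k} -> M := fglift f.
have FD u v : F (u + v) = F u + F v.
  have FB x y : F (x - y) = F x - F y by exact: lift_is_additive.
  have F0 : F 0 = 0 by rewrite -(subrr 0) FB subrr.
  by rewrite -[v in LHS]opprK FB -[- v]add0r FB F0 sub0r opprK.
have F0 : F 0 = 0 by apply: (addrI (F 0)); rewrite -FD !addr0.
move=> a u v; rewrite -/F FD; congr (_ + _).
have FS (s : seq X) (E : X -> {freeg X / k}) :
    F (\sum_(x <- s) E x) = \sum_(x <- s) F (E x).
  by elim: s => [|x s IH]; rewrite ?big_nil // !big_cons FD IH.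
rewrite {1}/GRing.scale /= /fgscale FS -[u in RHS]freeg_sumE FS scaler_sumr.
by apply: eq_bigr => x _; rewrite /F !liftU scalerA.
Qed.

HB.instance Definition _ :=
  GRing.isLinear.Build k {freeg X / k} M *:%R (fglift f) fglift_linear.

End FreeLift.

Section Tensor.
Variables (k : fieldType) (V W : lmodType k).

Inductive tensor_rel : {freeg (V * W) / k} -> Prop :=
| tensor_relDl v v' w :
    tensor_rel (<< (v + v', w) >> - << (v, w) >> - << (v', w) >>)
| tensor_relDr v w w' :
    tensor_rel (<< (v, w + w') >> - << (v, w) >> - << (v, w') >>)
| tensor_relZl a v w : tensor_rel (<< (a *: v, w) >> - a *: << (v, w) >>)
| tensor_relZr a v w : tensor_rel (<< (v, a *: w) >> - a *: << (v, w) >>).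

Definition tensor : Type := lquot tensor_rel.
HB.instance Definition _ := Choice.on tensor.
HB.instance Definition _ := GRing.Lmodule.on tensor.

Definition tens (v : V) (w : W) : tensor := lpi tensor_rel << (v, w) >>.

Lemma tens_bilinear : bilinear_for *:%R *:%R tens.
Proof.
have e (x y : tensor) : x - y = 0 -> x = y by move/eqP; rewrite subr_eq0 => /eqP.
have Zl a v w : tens (a *: v) w = a *: tens v w.
  by apply: e; rewrite /tens -linearZ -linearB; apply/lpi_gen/tensor_relZl.
have Zr a v w : tens v (a *: w) = a *: tens v w.
  by apply: e; rewrite /tens -linearZ -linearB; apply/lpi_gen/tensor_relZr.
split=> [w a v v'|v a w w'] /=.
  rewrite -Zl; apply: e; rewrite opprD addrA /tens -!linearB.
  exact/lpi_gen/tensor_relDl.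
rewrite -Zr; apply: e; rewrite opprD addrA /tens -!linearB.
exact/lpi_gen/tensor_relDr.
Qed.

HB.instance Definition _ :=
  bilinear_isBilinear.Build k V W tensor *:%R *:%R tens tens_bilinear.

Lemma tensDl v v' w : tens (v + v') w = tens v w + tens v' w.
Proof. exact: linearDl. Qed.
Lemma tensDr v w w' : tens v (w + w') = tens v w + tens v w'.
Proof. exact: linearDr. Qed.
Lemma tensZl a v w : tens (a *: v) w = a *: tens v w.
Proof. exact: linearZl_LR. Qed.
Lemma tensZr a v w : tens v (a *: w) = a *: tens v w.
Proof. exact: linearZr_LR. Qed.

Lemma tensor_ind (Q : tensor -> Prop) :
  Q 0 -> (forall v w t, Q t -> Q (tens v w + t)) -> forall t, Q t.
Proof.
move=> Q0 QD t; rewrite -[t]lpiK -[repr t]freeg_sumE.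
elim: (dom _) => [|x s IH]; first by rewrite big_nil linear0.
rewrite big_cons; case: x => v w. rewrite lpiD.
suff -> : lpi tensor_rel << coeff (v, w) (repr t) *g (v, w) >>
    = tens (coeff (v, w) (repr t) *: v) w by apply: QD.
rewrite tensZl /tens -lpi_scale; congr (lpi _ _).
by apply/eqP/freeg_eqP => y; rewrite coeffZ !coeffU mul1r.
Qed.

Variables (U : lmodType k) (f : {bilinear V -> W -> U}).

Lemma tlift_subproof g :
  tensor_rel g -> fglift (fun x : V * W => f x.1 x.2) g = 0.
Proof.
case=> [v v' w|v w w'|a v w|a v w]; rewrite !linearB ?linearZ /= !liftU !scale1r /=.
- by rewrite (linearDl f) addrAC addrK subrr.
- by rewrite (linearDr f) addrAC addrK subrr.
- by rewrite (linearZl_LR f) scalerN subrr.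
- by rewrite (linearZr_LR f) scalerN subrr.
Qed.

Definition tlift : tensor -> U := lquot_lift tlift_subproof.
HB.instance Definition _ := GRing.Linear.on tlift.

Lemma tliftE v w : tlift (tens v w) = f v w.
Proof. by rewrite /tlift /tens lquot_lift_pi /= liftU scale1r. Qed.
Lemma tlift0 : tlift 0 = 0. Proof. exact: linear0. Qed.
Lemma tliftD x y : tlift (x + y) = tlift x + tlift y. Proof. exact: linearD. Qed.

End Tensor.

Notation "V ** W" := (tensor V W) : type_scope.
Notation "V ** W" := (tensor V W) (only parsing) : ring_scope.
Notation "v *t w" := (tens v w) : ring_scope.

Lemma tensor_ext (k : fieldType) (V W U : lmodType k)
    (f g : {linear (V ** W) -> U}) :
  (forall v w, f (v *t w) = g (v *t w)) -> f =1 g.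
Proof.
move=> fg; apply: tensor_ind => [|v w t IH]; first by rewrite !linear0.
by rewrite !linearD fg IH.
Qed.

Section TensorMap.
Variables (k : fieldType) (V V' W W' : lmodType k).
Variables (f : {linear V -> V'}) (g : {linear W -> W'}).

Definition tmap_tens (v : V) (w : W) : V' ** W' := f v *t g w.

Lemma tmap_bilinear : bilinear_for *:%R *:%R tmap_tens.
Proof.
by split=> [w a v v'|v a w w'];
  rewrite /tmap_tens linearP ?tensDl ?tensDr ?tensZl ?tensZr.
Qed.

HB.instance Definition _ :=
  bilinear_isBilinear.Build k V W (V' ** W') *:%R *:%R tmap_tens tmap_bilinear.

Definition tmap : V ** W -> V' ** W' := tlift tmap_tens.
HB.instance Definition _ := GRing.Linear.on tmap.

Lemma tmapE v w : tmap (v *t w) = f v *t g w.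
Proof. exact: tliftE. Qed.
Lemma tmap0 : tmap 0 = 0. Proof. exact: linear0. Qed.
Lemma tmapD x y : tmap (x + y) = tmap x + tmap y. Proof. exact: linearD. Qed.
Lemma tmapZ a x : tmap (a *: x) = a *: tmap x. Proof. exact: linearZ. Qed.

End TensorMap.

Section TensorAssoc.
Variables (k : fieldType) (V W U : lmodType k).

Definition tensr (u : U) (w : W) : W ** U := w *t u.

Lemma tensr_linear u : linear (tensr u).
Proof. by move=> a w w'; rewrite /tensr tensDl tensZl. Qed.

HB.instance Definition _ u :=
  GRing.isLinear.Build k W (W ** U) *:%R (tensr u) (tensr_linear u).

Definition tassoc_tens (x : V ** W) (u : U) : V ** (W ** U) :=
  tmap idfun (tensr u) x.

Lemma tassoc_bilinear : bilinear_for *:%R *:%R tassoc_tens.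
Proof.
split=> [u a x y|x a u u'] /=; rewrite /tassoc_tens; first by rewrite linearP.
elim/tensor_ind: x => [|v w x IH]; first by rewrite !tmap0 scaler0 addr0.
by rewrite !tmapD IH !tmapE /= /tensr !tensDr !tensZr scalerDr addrACA.
Qed.

HB.instance Definition _ := bilinear_isBilinear.Build k (V ** W) U
  (V ** (W ** U)) *:%R *:%R tassoc_tens tassoc_bilinear.

Definition tassoc : (V ** W) ** U -> V ** (W ** U) := tlift tassoc_tens.
HB.instance Definition _ := GRing.Linear.on tassoc.

Lemma tassocE v w u : tassoc (v *t w *t u) = v *t (w *t u).
Proof. by rewrite /tassoc tliftE /= /tassoc_tens tmapE. Qed.

End TensorAssoc.

Section TensorUnit.
Variables (k : fieldType) (V : lmodType k).

Definition tscalel_tens (a : k^o) (v : V) : V := (a : k) *: v.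
Definition tscaler_tens (v : V) (a : k^o) : V := (a : k) *: v.

Lemma tscalel_bilinear : bilinear_for *:%R *:%R tscalel_tens.
Proof.
split=> [v a b c|c a v v']; rewrite /tscalel_tens /=.
  by rewrite [RHS](congr2 +%R (scalerA a (b : k) v) erefl) -scalerDl.
by rewrite scalerDr !scalerA mulrC.
Qed.

Lemma tscaler_bilinear : bilinear_for *:%R *:%R tscaler_tens.
Proof. by split=> [v|c]; [apply: tscalel_bilinear.2|apply: tscalel_bilinear.1]. Qed.

HB.instance Definition _ :=
  bilinear_isBilinear.Build k k^o V V *:%R *:%R tscalel_tens tscalel_bilinear.
HB.instance Definition _ :=
  bilinear_isBilinear.Build k V k^o V *:%R *:%R tscaler_tens tscaler_bilinear.

Definition tscalel : k^o ** V -> V := tlift tscalel_tens.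
Definition tscaler : V ** k^o -> V := tlift tscaler_tens.
HB.instance Definition _ := GRing.Linear.on tscalel.
HB.instance Definition _ := GRing.Linear.on tscaler.

Lemma tscalelE a v : tscalel (a *t v) = (a : k) *: v.
Proof. exact: tliftE. Qed.
Lemma tscalerE v a : tscaler (v *t a) = (a : k) *: v.
Proof. exact: tliftE. Qed.

End TensorUnit.

(* The zero ring, excluded by [algType], is a legitimate unital algebra here  *)
(* (a component of a covering may vanish).  The multiplication is a field of  *)
(* the mixin, because a structure inheriting from both [lmodType] and         *)
(* [pzRingType] would need a join below [lalgType]; the ring structure is     *)
(* derived just after, and [x * y] unfolds to [pz_mul x y].                   *)
HB.mixin Record Lmodule_isPzAlgebra (k : pzRingType) A
    of GRing.Lmodule k A := {
  pz_mul : A -> A -> A;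
  pz_one : A;
  pz_mulA : associative pz_mul;
  pz_mul1l : left_id pz_one pz_mul;
  pz_mul1r : right_id pz_one pz_mul;
  pz_mulDl : left_distributive pz_mul +%R;
  pz_mulDr : right_distributive pz_mul +%R;
  pz_mulZl : forall (a : k) x y, a *: pz_mul x y = pz_mul (a *: x) y;
  pz_mulZr : forall (a : k) x y, a *: pz_mul x y = pz_mul x (a *: y)
}.

#[short(type="pzAlgType")]
HB.structure Definition PzAlgebra (k : pzRingType) :=
  {A of GRing.Lmodule k A & Lmodule_isPzAlgebra k A}.

#[non_forgetful_inheritance]
HB.instance Definition _ (k : pzRingType) (A : pzAlgType k) :=
  GRing.Zmodule_isPzRing.Build A (@pz_mulA k A) (@pz_mul1l k A)
    (@pz_mul1r k A) (@pz_mulDl k A) (@pz_mulDr k A).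

Lemma pz_scalerAl (k : pzRingType) (A : pzAlgType k) (a : k) (x y : A) :
  a *: (x * y) = (a *: x) * y.
Proof. exact: pz_mulZl. Qed.

Lemma pz_scalerAr (k : pzRingType) (A : pzAlgType k) (a : k) (x y : A) :
  a *: (x * y) = x * (a *: y).
Proof. exact: pz_mulZr. Qed.

HB.instance Definition _ (k : fieldType) :=
  Lmodule_isPzAlgebra.Build k k^o
    (@mulrA k) (@mul1r k) (@mulr1 k) (@mulrDl k) (@mulrDr k)
    (fun a x y => @scalerAl k k^o a x y) (fun a x y => @scalerAr k k^o a x y).

Record alg_hom (k : pzRingType) (A B : pzAlgType k) := AlgHom {
  alg_hom_lin :> {linear A -> B};
  alg_hom_monoid : monoid_morphism alg_hom_lin
}.

Section AlgHomTheory.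
Variables (k : pzRingType) (A B : pzAlgType k) (f : alg_hom A B).
Lemma alg_hom1 : f 1 = 1. Proof. by case: (alg_hom_monoid f). Qed.
Lemma alg_homM : {morph f : x y / x * y}.
Proof. by case: (alg_hom_monoid f). Qed.
End AlgHomTheory.

Section AlgMul.
Variables (k : fieldType) (A : pzAlgType k).

Definition mull (a x : A) : A := a * x.

Lemma mull_linear a : linear (mull a).
Proof. by move=> c x y; rewrite /mull mulrDr pz_scalerAr. Qed.

HB.instance Definition _ a :=
  GRing.isLinear.Build k A A *:%R (mull a) (mull_linear a).

Lemma mull_bilinear : bilinear_for *:%R *:%R mull.
Proof.
split=> [x c a b|a]; last exact: mull_linear.
by rewrite /mull mulrDl [LHS](congr2 +%R (esym (pz_scalerAl c a x)) erefl).
Qed.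

HB.instance Definition _ :=
  bilinear_isBilinear.Build k A A A *:%R *:%R mull mull_bilinear.

Definition tmult : A ** A -> A := tlift mull.
HB.instance Definition _ := GRing.Linear.on tmult.

Lemma tmultE a b : tmult (a *t b) = a * b.
Proof. exact: tliftE. Qed.

End AlgMul.

Section TensorAlgebra.
Variables (k : fieldType) (A B : pzAlgType k).

Definition tmul_tens (y : A ** B) (a : A) (b : B) : A ** B :=
  tmap (mull a) (mull b) y.

Lemma tmul_tens_bilinear y : bilinear_for *:%R *:%R (tmul_tens y).
Proof.
split=> [b c a a'|a c b b'] /=; rewrite /tmul_tens;
  elim/tensor_ind: y => [|v w y IH]; rewrite ?tmap0 ?scaler0 ?addr0 //;
  rewrite !tmapD IH !tmapE /= /mull mulrDl -pz_scalerAl scalerDr.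
- by rewrite tensDl tensZl addrACA.
- by rewrite tensDr tensZr addrACA.
Qed.

HB.instance Definition _ y := bilinear_isBilinear.Build k A B (A ** B)
  *:%R *:%R (tmul_tens y) (tmul_tens_bilinear y).

Definition tmul (x y : A ** B) : A ** B := tlift (tmul_tens y) x.

Lemma tmulE a b a' b' : tmul (a *t b) (a' *t b') = (a * a') *t (b * b').
Proof. by rewrite /tmul tliftE /= /tmul_tens tmapE. Qed.

Lemma tmul_linearl y : linear (tmul^~ y).
Proof. by move=> c x x'; rewrite /tmul linearP. Qed.

Lemma tmul_linearr x : linear (tmul x).
Proof.
move=> c y y'; rewrite /tmul; elim/tensor_ind: x => [|a b x IH].
  by rewrite !tlift0 scaler0 addr0.
rewrite !tliftD IH !tliftE /= /tmul_tens tmapD tmapZ scalerDr.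
exact: addrACA.
Qed.

Lemma tmulDl : left_distributive tmul +%R.
Proof. by move=> x y z; have := tmul_linearl z 1 x y; rewrite !scale1r. Qed.
Lemma tmulDr : right_distributive tmul +%R.
Proof. by move=> x y z; have := tmul_linearr x 1 y z; rewrite !scale1r. Qed.
Lemma tmul0l y : tmul 0 y = 0.
Proof. by rewrite /tmul linear0. Qed.
Lemma tmul0r x : tmul x 0 = 0.
Proof. by apply: (addrI (tmul x 0)); rewrite -tmulDr !addr0. Qed.
Lemma tmulZl c x y : c *: tmul x y = tmul (c *: x) y.
Proof. by rewrite /tmul linearZ. Qed.
Lemma tmulZr c x y : c *: tmul x y = tmul x (c *: y).
Proof. by have := tmul_linearr x c y 0; rewrite tmul0r !addr0. Qed.

Lemma tmulA : associative tmul.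
Proof.
move=> x y z; elim/tensor_ind: x => [|a b x IHx]; first by rewrite !tmul0l.
rewrite !tmulDl IHx; congr (_ + _).
elim/tensor_ind: y {x IHx} => [|a' b' y IHy]; first by rewrite tmul0l !tmul0r tmul0l.
rewrite tmulDl !tmulDr tmulDl IHy; congr (_ + _).
elim/tensor_ind: z {y IHy} => [|a'' b'' z IHz]; first by rewrite !tmul0r.
by rewrite !tmulDr IHz !tmulE !mulrA.
Qed.

Lemma tmul1l : left_id ((1 : A) *t (1 : B)) tmul.
Proof.
elim/tensor_ind=> [|a b x IH]; first exact: tmul0r.
by rewrite tmulDr IH tmulE !mul1r.
Qed.

Lemma tmul1r : right_id ((1 : A) *t (1 : B)) tmul.
Proof.
elim/tensor_ind=> [|a b x IH]; first exact: tmul0l.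
by rewrite tmulDl IH tmulE !mulr1.
Qed.

HB.instance Definition _ := GRing.Zmodule_isPzRing.Build (A ** B)
  tmulA tmul1l tmul1r tmulDl tmulDr.
HB.instance Definition _ := Lmodule_isPzAlgebra.Build k (A ** B)
  tmulA tmul1l tmul1r tmulDl tmulDr tmulZl tmulZr.

Lemma tensM a b a' b' :
  (a *t b) * (a' *t b') = (a * a') *t (b * b') :> A ** B.
Proof. exact: tmulE. Qed.

Lemma tens1 : (1 : A) *t (1 : B) = 1. Proof. by []. Qed.

End TensorAlgebra.

(* [tscalel] and [tscaler] are the canonical maps from k (x) H and H (x) k    *)
(* to H; [pz_one] is the unit 1 of H.                                         *)
HB.mixin Record PzAlgebra_isHopfAlgebra (k : fieldType) H
    of PzAlgebra k H := {
  comul : alg_hom H (H ** H);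
  counit : alg_hom H k^o;
  antipode : {linear H -> H};
  comulA : forall h,
    tassoc (tmap comul idfun (comul h)) = tmap idfun comul (comul h);
  counitl : forall h, tscalel (tmap counit idfun (comul h)) = h;
  counitr : forall h, tscaler (tmap idfun counit (comul h)) = h;
  antipodel : forall h,
    tmult (tmap antipode idfun (comul h)) = (counit h : k) *: pz_one;
  antipoder : forall h,
    tmult (tmap idfun antipode (comul h)) = (counit h : k) *: pz_one
}.

#[short(type="hopfAlgType")]
HB.structure Definition HopfAlgebra (k : fieldType) :=
  {H of PzAlgebra k H & PzAlgebra_isHopfAlgebra k H}.

#[non_forgetful_inheritance]
HB.instance Definition _ (k : fieldType) (H : hopfAlgType k) :=
  GRing.PzRing.copy H (H : pzAlgType k).

HB.mixin Record PzAlgebra_isComoduleAlgebra (k : fieldType)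
    (H : hopfAlgType k) P of PzAlgebra k P := {
  coact : alg_hom P (P ** H);
  coactA : forall p,
    tassoc (tmap coact idfun (coact p)) = tmap idfun comul (coact p);
  coact1 : forall p, tscaler (tmap idfun counit (coact p)) = p
}.

#[short(type="comodAlgType")]
HB.structure Definition ComoduleAlgebra (k : fieldType) (H : hopfAlgType k) :=
  {P of PzAlgebra k P & PzAlgebra_isComoduleAlgebra k H P}.

#[non_forgetful_inheritance]
HB.instance Definition _ (k : fieldType) (H : hopfAlgType k)
    (P : comodAlgType H) :=
  GRing.PzRing.copy P (P : pzAlgType k).

Record comod_alg_hom (k : fieldType) (H : hopfAlgType k)
    (P Q : comodAlgType H) := ComodAlgHom {
  comod_alg_hom_alg :> alg_hom P Q;
  comod_alg_hom_colinear : forall p,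
    coact (comod_alg_hom_alg p) = tmap comod_alg_hom_alg idfun (coact p)
}.

Section Coinvariants.
Variables (k : fieldType) (H : hopfAlgType k) (P : comodAlgType H).

Definition coinv_pred : {pred P} := fun p => coact p == p *t (1 : H).

Lemma coinvP p : reflect (coact p = p *t (1 : H)) (p \in coinv_pred).
Proof. exact: eqP. Qed.

Lemma coinv_subring : subring_closed coinv_pred.
Proof.
split=> [|p q /coinvP cp /coinvP cq|p q /coinvP cp /coinvP cq]; apply/coinvP.
- exact: (alg_hom1 coact).
- by rewrite linearB cp cq -scaleN1r -tensZl -tensDl scaleN1r.
- by rewrite (alg_homM coact) cp cq tensM mulr1.
Qed.

Lemma coinv_submod : submod_closed coinv_pred.
Proof.
split=> [|a p q /coinvP cp /coinvP cq]; apply/coinvP.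
  by rewrite linear0 -(scale0r (0 : P)) tensZl scale0r.
by rewrite linearP cp cq tensDl tensZl.
Qed.

HB.instance Definition _ := GRing.isSubringClosed.Build P coinv_pred
  coinv_subring.
HB.instance Definition _ := GRing.isSubmodClosed.Build k P coinv_pred
  coinv_submod.

Record coinv := Coinv { coinv_val : P; coinv_valP : coinv_pred coinv_val }.

HB.instance Definition _ := [isSub for coinv_val].
HB.instance Definition _ := [Choice of coinv by <:].
HB.instance Definition _ := [SubChoice_isSubZmodule of coinv by <:].
HB.instance Definition _ := GRing.SubZmodule_isSubPzRing.Build P coinv_pred
  coinv coinv_subring.
HB.instance Definition _ := GRing.SubZmodule_isSubLmodule.Build k P
  coinv_pred coinv (GRing.submod_closed_semi coinv_submod).

Lemma coinv_mulZl (a : k) (x y : coinv) : a *: (x * y) = (a *: x) * y.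
Proof. apply: val_inj; exact: pz_scalerAl. Qed.

Lemma coinv_mulZr (a : k) (x y : coinv) : a *: (x * y) = x * (a *: y).
Proof. apply: val_inj; exact: pz_scalerAr. Qed.

HB.instance Definition _ := Lmodule_isPzAlgebra.Build k coinv
  (@mulrA _) (@mul1r _) (@mulr1 _) (@mulrDl _) (@mulrDr _)
  coinv_mulZl coinv_mulZr.

End Coinvariants.

Section CoinvariantHom.
Variables (k : fieldType) (H : hopfAlgType k) (P Q : comodAlgType H).
Variable f : comod_alg_hom P Q.

Lemma coinv_hom_subproof (b : coinv P) : coinv_pred (f (val b)).
Proof.
apply/eqP; rewrite comod_alg_hom_colinear (eqP (coinv_valP b)).
exact: tmapE.
Qed.

Definition coinv_fun (b : coinv P) : coinv Q := Coinv (coinv_hom_subproof b).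

Lemma coinv_fun_linear : linear coinv_fun.
Proof. move=> a b c; apply: val_inj; exact: linearP. Qed.

HB.instance Definition _ :=
  GRing.isLinear.Build k (coinv P) (coinv Q) *:%R coinv_fun coinv_fun_linear.

Lemma coinv_fun_monoid : monoid_morphism coinv_fun.
Proof.
split=> [|b c]; apply: val_inj; first exact: (alg_hom1 f).
exact: (alg_homM f).
Qed.

Definition coinv_hom : alg_hom (coinv P) (coinv Q) :=
  AlgHom (alg_hom_lin := coinv_fun) coinv_fun_monoid.

End CoinvariantHom.

Section Principal.
Variables (k : fieldType) (H : hopfAlgType k) (P : comodAlgType H).
Local Notation B := (coinv P).

Definition balanced_rel : set (P ** P) :=
  [set t | exists (p : P) (b : B) (q : P),
     t = (p * val b) *t q - p *t (val b * q)].

(* P (x)_B P as the quotient of P (x)_k P; since k.1 is contained in B, this  *)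
(* is also the tensor product over B of abelian groups.                       *)
Definition btensor : lmodType k := lquot balanced_rel.

Definition can_tens (p q : P) : P ** H := tmap (mull p) idfun (coact q).

Lemma can_tens_bilinear : bilinear_for *:%R *:%R can_tens.
Proof.
split=> [q a p p'|p a q q'] /=; rewrite /can_tens; last by rewrite !linearP.
elim/tensor_ind: (coact q) => [|v h x IH].
  by rewrite !tmap0 scaler0 addr0.
rewrite !tmapD IH !tmapE /= /mull mulrDl -pz_scalerAl tensDl tensZl scalerDr.
exact: addrACA.
Qed.

HB.instance Definition _ := bilinear_isBilinear.Build k P P (P ** H)
  *:%R *:%R can_tens can_tens_bilinear.

Definition can_lift : P ** P -> P ** H := tlift can_tens.
HB.instance Definition _ := GRing.Linear.on can_lift.

Lemma can_liftE p q : can_lift (p *t q) = tmap (mull p) idfun (coact q).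
Proof. exact: tliftE. Qed.

Lemma can_subproof t : balanced_rel t -> can_lift t = 0.
Proof.
case=> p [b [q ->]]; apply/eqP; rewrite (linearB can_lift) subr_eq0; apply/eqP.
rewrite /= !can_liftE (alg_homM coact) (eqP (coinv_valP b)).
elim/tensor_ind: (coact q) => [|v h x IH]; first by rewrite mulr0 !tmap0.
by rewrite mulrDr !tmapD IH tensM !tmapE /= mul1r /mull mulrA.
Qed.

Definition can : btensor -> P ** H := lquot_lift can_subproof.
HB.instance Definition _ := GRing.Linear.on can.

Lemma canE (p q : P) :
  can (lpi balanced_rel (p *t q)) = tmap (mull p) idfun (coact q).
Proof. by rewrite /can lquot_lift_pi /= can_liftE. Qed.

Definition bact_tens (b : B) (p : P) : P := val b * p.

Lemma bact_bilinear : bilinear_for *:%R *:%R bact_tens.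
Proof.
split=> [p a b b'|b a p p']; rewrite /bact_tens.
  exact: (mull_bilinear P).1.
exact: (mull_bilinear P).2.
Qed.

HB.instance Definition _ :=
  bilinear_isBilinear.Build k B P P *:%R *:%R bact_tens bact_bilinear.

Definition bact : B ** P -> P := tlift bact_tens.

(* The coaction id (x) Delta_P on B (x) P lands in B (x) (P (x) H), hence the *)
(* reassociation of (s (x) id) \o Delta_P in the colinearity condition.       *)
Definition has_splitting : Prop :=
  exists s : {linear P -> (B ** P)},
    [/\ forall p, bact (s p) = p,
        forall (b : B) p, s (val b * p) = tmap (mull b) idfun (s p)
      & forall p, tassoc (tmap s idfun (coact p)) = tmap idfun coact (s p)].

Definition principal : Prop := bijective can /\ has_splitting.

End Principal.

Section Covering.
Variables (k : fieldType) (A : pzAlgType k).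

Definition ideal_add (I J : set A) : set A :=
  [set x | exists2 y, I y & exists2 z, J z & x = y + z].

(* The smallest family containing the G i and closed under + and `&`. *)
Inductive ideal_lattice (X : Type) (G : X -> set A) : set A -> Prop :=
| ideal_lattice_gen i : ideal_lattice G (G i)
| ideal_lattice_add I J :
    ideal_lattice G I -> ideal_lattice G J -> ideal_lattice G (ideal_add I J)
| ideal_lattice_cap I J :
    ideal_lattice G I -> ideal_lattice G J -> ideal_lattice G (I `&` J).

(* In a lattice this law is equivalent to its dual. *)
Definition distributive_lattice (L : set (set A)) : Prop :=
  forall I J K, L I -> L J -> L K ->
    I `&` ideal_add J K = ideal_add (I `&` J) (I `&` K).

Definition ker (B : pzAlgType k) (f : alg_hom A B) : set A :=
  [set x | f x = 0].

Definition covering (N : nat) (A_ : 'I_N -> pzAlgType k)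
    (pi : forall i, alg_hom A (A_ i)) : Prop :=
  [/\ forall i y, exists x, pi i x = y,
      \bigcap_i ker (pi i) = [set 0]
    & distributive_lattice (ideal_lattice (fun i => ker (pi i)))].

End Covering.

(* Main.v *)
(* Applied to can^-1, the splitting s gives a strong connection, so that       *)
(* (id (x) f)(s(p)), multiplied out, has the form p_(0) g(p_(1)) for a linear  *)
(* g : H -> P. Maps p |-> p_(0) g(p_(1)) are compatible with comodule algebra  *)
(* maps, hence preserve every ideal K in the lattice generated by the kernels. *)
(* With B the coinvariants:                                                    *)
(* - for f a linear retraction of P onto B, the result is a left B-linear      *)
(*   projection P -> B preserving all K; so K |-> K cap B commutes with sums,  *)
(*   and the maps P^coH -> P_i^coH are onto;                                   *)
(* - for f a functional, one gets the slices of s(p), and p lies in the right  *)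
(*   ideal they generate; so K is determined by K cap B.                       *)
(* Hence K |-> K cap B is an isomorphism onto the lattice generated by the     *)
(* kernels in B.                                                               *)
Require Import Defs.
From HB Require Import structures.
From mathcomp Require Import all_boot all_algebra.
From mathcomp Require Import boolp classical_sets.

Set Implicit Arguments.
Unset Strict Implicit.
Unset Printing Implicit Defensive.

Import GRing.Theory.
Local Open Scope ring_scope.

(** The ideals in play are right ideals stable under all maps p |-> p_(0) g(p_(1)) ([stable_ker],
    [stable_add], [stable_cap]), and [stwist_coact] extracts useful maps of this form from
    principality. One of them projects P onto B ([principal_total_integral]): it turns a
    decomposition of an invariant element into one with invariant summands ([contract_add]) and
    lifts invariant elements along surjections ([coinv_hom_surj]). The others are slices of the
    splitting, and they show that inclusions between stable ideals can be tested on B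
    ([stable_subset]). The three clauses of a covering then transfer one by one, the last two by
    [bigcap_ker_contract] and [distributive_contract]. *)

Section LinearAlgebra.
Variable k : fieldType.

(** * Retractions and functionals modulo a span *)

Lemma mspanB (V : lmodType k) (G : set V) u v :
  mspan G u -> mspan G v -> mspan G (u - v).
Proof. by move=> Gu Gv; rewrite -scaleN1r; apply/mspanD/mspanZ. Qed.

Lemma mspan_mono (V : lmodType k) (G G' : set V) v :
  (G `<=` G')%classic -> mspan G v -> mspan G' v.
Proof.
by move=> GG'; elim=> [|a g w Gg _ IH]; [apply: mspan0|apply: mspan_comb; auto].
Qed.

(** By Zorn's lemma there is a maximal [A] such that the span of [G] and [A] meets the image of [i]
    trivially. That span is a complement of the image, and [r] is the projection along it. *)
Lemma linear_retraction (X V : lmodType k) (i : {linear X -> V}) (G : set V) :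
  (forall x, mspan G (i x) -> x = 0) ->
  exists2 r : {linear V -> X}, cancel i r & forall v, mspan G v -> r v = 0.
Proof.
move=> Gi.
pose indep (A : set V) := forall x, mspan (G `|` A)%classic (i x) -> x = 0.
have [F indepF chF|A [indepA maxA]] := @Zorn_bigcup V indep.
  (* The first alternative takes care of the empty chain. *)
  have chain : forall v, mspan (G `|` \bigcup_(X in F) X)%classic v ->
      mspan G v \/ exists2 A, F A & mspan (G `|` A)%classic v.
  - move=> v; elim=> [|a g w [Gg|[B FB Bg]] _ IH].
    + by left; apply: mspan0.
    + case: IH => [IH|[A FA IH]]; first by left; apply: mspan_comb.
      by right; exists A => //; apply: mspan_comb => //; left.
    + right; case: IH => [IH|[A FA IH]].
        exists B => //; apply: mspan_comb; first by right.
        by apply: mspan_mono IH => y; left.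
      case: (chF A B FA FB) => sAB; [exists B | exists A] => //.
        apply: mspan_comb; first by right.
        by apply: mspan_mono IH => y [Gy|Ay]; [left|right; apply: sAB].
      by apply: mspan_comb => //; right; apply: sAB.
  - by move=> x Bx; case: (chain _ Bx) => [/Gi//|[A FA]]; apply: indepF.
pose S := mspan (G `|` A)%classic.
have cover v : exists x, S (v - i x).
  have [Av|nAv] := pselect (A v).
    by exists 0; rewrite linear0 subr0; apply: mspan_gen; right.
  (* By maximality, adding [v] makes some nonzero [i x] fall into the span. The coefficient of [v]
     there is nonzero, so [v] can be solved for. *)
  have /maxA : (A `<` A `|` [set v])%classic.
    by split=> [y|/(_ v)]; [left|move=> sA; apply: nAv; apply: sA; right].
  move=> /existsNP[x /not_implyP[Bx x0]].
  have [a Sa] : exists a, S (i x - a *: v).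
    elim: Bx {x0} => [|b g w Bg _ [a Sa]].
      by exists 0; rewrite scale0r subr0; apply: mspan0.
    case: Bg => [Gg|[Ag|->]].
    - by exists a; rewrite -addrA; apply: mspan_comb => //; left.
    - by exists a; rewrite -addrA; apply: mspan_comb => //; right.
    - by exists (b + a); rewrite scalerDl opprD addrACA subrr add0r.
  have [a0|a0] := eqVneq a 0.
    by case: x0; apply: indepA; move: Sa; rewrite a0 scale0r subr0.
  exists (a^-1 *: x); rewrite -[v]scale1r -(mulVf a0) -scalerA [i _]linearZ /=.
  by rewrite -scalerBr -opprB -scaleN1r; do 2 apply: mspanZ.
have [r Sr] := choice cover.
have rP v x : S (v - i x) -> r v = x.
  move=> Sx; apply/eqP; rewrite -subr_eq0; apply/eqP/indepA.
  have -> : i (r v - x) = (v - i x) - (v - i (r v)).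
    by rewrite linearB opprB [RHS]addrC addrA subrK.
  exact: mspanB Sx (Sr v).
have rlin : linear r.
  move=> a u v; apply: rP; rewrite linearP opprD addrACA -scalerBr.
  exact: mspanD (mspanZ a (Sr u)) (Sr v).
exists (HB.pack_for {linear V -> X} r (GRing.isLinear.Build k V X *:%R r rlin)).
  by move=> x; apply: rP; rewrite subrr; apply: mspan0.
by move=> v Gv; apply: rP; rewrite linear0 subr0; apply: mspan_mono Gv => y; left.
Qed.

Lemma separating_functional (V : lmodType k) (G : set V) v :
  ~ mspan G v ->
  exists2 phi : {linear V -> k^o}, phi v = 1 & forall w, mspan G w -> phi w = 0.
Proof.
move=> Gv; pose l (a : k^o) : V := (a : k) *: v.
have llin : linear l by move=> a b c; apply: (tscalel_bilinear V).1.
pose i := HB.pack_for {linear k^o -> V} l (GRing.isLinear.Build k k^o V *:%R l llin).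
have [a Ga|r ri r0] := @linear_retraction _ _ i G.
  have [//|a0] := eqVneq (a : k) 0; case: Gv.
  by rewrite -[v]scale1r -(mulVf a0) -scalerA; apply: mspanZ.
by exists r => //; rewrite -[RHS]ri /= /l scale1r.
Qed.

(** * Tensors and their slices *)

Section Slices.
Variables V W : lmodType k.

Definition tsum (s : seq (V * W)) : V ** W := \sum_(x <- s) x.1 *t x.2.

Lemma tsumP (t : V ** W) : exists s, t = tsum s.
Proof.
elim/tensor_ind: t => [|v w t [s ->]]; first by exists [::]; rewrite /tsum big_nil.
by exists ((v, w) :: s); rewrite /tsum big_cons.
Qed.

Definition slice (phi : {linear W -> k^o}) (t : V ** W) : V :=
  tscaler (tmap idfun phi t).
HB.instance Definition _ phi := GRing.Linear.copy (slice phi) (@tscaler k V \o tmap idfun phi).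

Lemma sliceE phi v w : slice phi (v *t w) = (phi w : k) *: v.
Proof. by rewrite /slice tmapE tscalerE. Qed.

Lemma slice0 phi : slice phi 0 = 0. Proof. exact: linear0. Qed.
Lemma sliceD phi x y : slice phi (x + y) = slice phi x + slice phi y.
Proof. exact: linearD. Qed.

Lemma slice_tsum phi s : slice phi (tsum s) = \sum_(x <- s) (phi x.2 : k) *: x.1.
Proof. by rewrite linear_sum; apply: eq_bigr => x _; apply: sliceE. Qed.

Lemma tsum_absorb s v w : mspan [set` unzip2 s]%classic w ->
  exists2 s', unzip2 s' = unzip2 s & v *t w + tsum s = tsum s'.
Proof.
elim=> [|a g u sg _ [s' ss' e]].
  by exists s => //; rewrite linear0r add0r.
rewrite tensDr -addrA e tensZr -tensZl -ss' in sg *.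
elim: s' sg {s e u ss'} => // -[x y] s' IH /=; rewrite inE => /orP[/eqP->|].
  exists ((a *: v + x, y) :: s') => //.
  by rewrite /tsum !big_cons /= addrA -tensDl.
case/IH => s2 s2E e; exists ((x, y) :: s2); first by rewrite /= s2E.
by rewrite {2}/tsum big_cons -/(tsum _) -e addrCA /tsum big_cons.
Qed.

(* Induction on the number of terms: either the second leg of the first term  *)
(* depends on the others and can be absorbed, or a functional isolates it.    *)
Lemma slices_tens (M : set V) (t : V ** W) :
  M 0 -> (forall a u v, M u -> M v -> M (a *: u + v)) ->
  (forall phi, M (slice phi t)) ->
  mspan [set x | exists2 m, M m & exists w, x = m *t w]%classic t.
Proof.
move=> M0 MP; have [s ->] := tsumP t.
have [n] := ubnP (size s); elim: n s => // n IH [_ _|[v w] s /= sn Ms].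
  by rewrite /tsum big_nil; apply: mspan0.
have [/(tsum_absorb v)[s' ss' e]|/separating_functional[phi phiw phi0]] :=
    pselect (mspan [set` unzip2 s]%classic w).
  move: Ms; rewrite /tsum big_cons -/(tsum s) e => Ms; apply: IH => //.
  by rewrite -(size_map snd s') -/(unzip2 s') ss' size_map.
have Mv : M v.
  move: (Ms phi); rewrite slice_tsum big_cons phiw scale1r big_seq big1 ?addr0 //.
  move=> x xs; rewrite phi0 ?scale0r //.
  by apply: mspan_gen; apply: map_f.
rewrite /tsum big_cons -[v *t w]scale1r; apply: mspan_comb; first by exists v => //; exists w.
(* Dropping the first term changes each slice by a multiple of [v], which already lies in [M]. *)
apply: IH => // psi; have := MP (- (psi w : k)) _ _ Mv (Ms psi).
by rewrite !slice_tsum big_cons scaleNr addKr.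
Qed.

End Slices.

Section Swap.
Variables V W : lmodType k.

Definition swap_tens (v : V) (w : W) : W ** V := w *t v.

Lemma swap_bilinear : bilinear_for *:%R *:%R swap_tens.
Proof.
by split=> [w a v v'|v a w w'];
  rewrite /swap_tens ?tensDl ?tensDr ?tensZl ?tensZr.
Qed.

HB.instance Definition _ :=
  bilinear_isBilinear.Build k V W (W ** V) *:%R *:%R swap_tens swap_bilinear.

Definition tswap : V ** W -> W ** V := tlift swap_tens.
HB.instance Definition _ := GRing.Linear.on tswap.

Lemma tswapE v w : tswap (v *t w) = w *t v.
Proof. exact: tliftE. Qed.

Lemma tswap0 : tswap 0 = 0. Proof. exact: tlift0. Qed.
Lemma tswapD x y : tswap (x + y) = tswap x + tswap y. Proof. exact: tliftD. Qed.

End Swap.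

Lemma tswapK (V W : lmodType k) : cancel (@tswap V W) (@tswap W V).
Proof.
elim/tensor_ind=> [|v w t IH]; first by rewrite !tswap0.
by rewrite !tswapD IH !tswapE.
Qed.

End LinearAlgebra.

(** * The strong connection of a principal comodule algebra *)

Section StrongConnection.
Variables (k : fieldType) (H : hopfAlgType k) (P : comodAlgType H).
Local Notation B := (coinv P).
Variables (s : {linear P -> (B ** P)}) (f : {linear P -> P}).
Hypothesis sB : forall (b : B) p, s (val b * p) = tmap (mull b) idfun (s p).

Definition stwist : P -> P := fun q => tmult (tmap val f (s q)).

Lemma stwist_linear : linear stwist.
Proof. by move=> a u v; rewrite /stwist !linearP. Qed.

HB.instance Definition _ := GRing.isLinear.Build k P P *:%R stwist stwist_linear.

Lemma stwistM (b : B) q : stwist (val b * q) = val b * stwist q.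
Proof.
rewrite /stwist sB; elim/tensor_ind: (s q) => [|c p t IH].
  by rewrite !linear0 mulr0.
by rewrite !linearD mulrDr -IH /= !tmapE !tmultE /= -mulrA.
Qed.

Definition stwist_tens (p q : P) : P := p * stwist q.

Lemma stwist_tens_bilinear : bilinear_for *:%R *:%R stwist_tens.
Proof.
split=> [q|p] a u v; first exact: (mull_bilinear P).1.
by rewrite /stwist_tens linearP; apply: (mull_bilinear P).2.
Qed.

HB.instance Definition _ :=
  bilinear_isBilinear.Build k P P P *:%R *:%R stwist_tens stwist_tens_bilinear.

Lemma stwist_balanced t : balanced_rel t -> tlift stwist_tens t = 0.
Proof.
case=> p [b [q ->]]; rewrite (linearB (tlift stwist_tens)) /= !tliftE /=.
by rewrite /stwist_tens stwistM mulrA subrr.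
Qed.

Definition bstwist : btensor P -> P := lquot_lift stwist_balanced.
HB.instance Definition _ := GRing.Linear.on bstwist.

Lemma can_mull x (t : P ** P) :
  can_lift (tmap (mull x) idfun t) = tmap (mull x) idfun (can_lift t).
Proof.
rewrite /can_lift; elim/tensor_ind: t => [|p q t IH].
  by rewrite !(tmap0, tlift0).
rewrite !(tmapD, tliftD) IH tmapE !tliftE; congr (_ + _).
rewrite /= /can_tens.
elim/tensor_ind: (coact q) => [|v h u IHu]; first by rewrite !linear0.
by rewrite !tmapD IHu !tmapE /= /mull mulrA.
Qed.

(* With l(h) = (id (x)_B s)(can^-1 (1 (x) h)), a strong connection, one has   *)
(* s(q) = q_(0) l(q_(1)); here g is l followed by id (x) f and multiplication. *)
Lemma stwist_coact : bijective (@can k H P) ->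
  exists g : {linear H -> P}, forall q, stwist q = tmult (tmap idfun g (coact q)).
Proof.
move=> [c canK cK].
have clin : linear c.
  by move=> a u v; apply: (can_inj canK); rewrite cK (linearP (@can k H P)) /= !cK.
pose g0 h := bstwist (c ((1 : P) *t h)).
have g0lin : linear g0.
  by move=> a u v; rewrite /g0 tensDr tensZr clin (linearP bstwist).
pose g := HB.pack_for {linear H -> P} g0 (GRing.isLinear.Build k H P *:%R g0 g0lin).
exists g => q.
(* The canonical map is left P-linear ([can_mull]), hence so is its inverse. *)
have cM x u : bstwist (c (tmap (mull x) idfun u)) = x * bstwist (c u).
  rewrite -[u in LHS]cK -[c u]lpiK; set t := repr _.
  rewrite /can lquot_lift_pi -can_mull.
  rewrite -(lquot_lift_pi (@can_subproof _ _ P)) -/(can _) canK.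
  rewrite /bstwist !lquot_lift_pi /=.
  elim/tensor_ind: t => [|p p' t IH]; first by rewrite tmap0 tlift0 mulr0.
  by rewrite tmapD !tliftD IH mulrDr tmapE !tliftE /= /stwist_tens /mull mulrA.
(* By left P-linearity, the values on 1 (x) h, which define [g], determine the map on all of P (x)
   H. *)
have gc u : tmult (tmap idfun g u) = bstwist (c u).
  elim/tensor_ind: u => [|x h u IH].
    by rewrite !linear0 -[0 in RHS](linear0 (@can k H P)) canK linear0.
  rewrite tmapD tmapE (linearD (@tmult k P)) /= tmultE IH.
  have -> y z : c (y + z) = c y + c z by have := clin 1 y z; rewrite !scale1r.
  rewrite (linearD bstwist) /=; congr (_ + _).
  by have := cM x ((1 : P) *t h); rewrite tmapE /= /mull mulr1.
have <- : can (lpi (@balanced_rel k H P) ((1 : P) *t q)) = coact q.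
  rewrite canE; elim/tensor_ind: (coact q) => [|v h u IH]; first by rewrite tmap0.
  by rewrite tmapD IH tmapE /= /mull mul1r.
rewrite gc canK /bstwist lquot_lift_pi /= tliftE /=.
by rewrite /stwist_tens mul1r.
Qed.
End StrongConnection.

(** * Ideals stable under p |-> p_(0) g(p_(1)) *)

Section StableIdeals.
Variables (k : fieldType) (H : hopfAlgType k) (P : comodAlgType H).
Local Notation B := (coinv P).
Local Notation coinvs := (@coinv_pred k H P).

Definition coact_conv (g : {linear H -> P}) (p : P) : P :=
  tmult (tmap idfun g (coact p)).

Lemma coact_conv_linear g : linear (coact_conv g).
Proof. by move=> a u v; rewrite /coact_conv !linearP. Qed.

HB.instance Definition _ g :=
  GRing.isLinear.Build k P P *:%R (coact_conv g) (coact_conv_linear g).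

Lemma coact_conv_coinv g (p : P) : p \in coinvs -> coact_conv g p = p * g 1.
Proof. by move=> /coinvP cp; rewrite /coact_conv cp tmapE tmultE. Qed.

Lemma coact_conv_hom (Q : comodAlgType H) (f : comod_alg_hom P Q) g p :
  f (coact_conv g p) = tmult (tmap idfun (f \o g) (coact (f p))).
Proof.
rewrite comod_alg_hom_colinear /coact_conv.
elim/tensor_ind: (coact p) => [|x h u IH]; first by rewrite !linear0.
rewrite !tmapD !tmapE !(linearD (@tmult _ _)) /= (linearD f) IH !tmultE.
by rewrite (alg_homM f).
Qed.

(** The splitting writes p as a sum of products b q with b in B on the left, so membership of the b
    is passed on to p by right multiplication. *)
Record right_ideal (K : set P) : Prop := RightIdeal {
  right_ideal0 : K 0;
  right_idealP : forall (a : k) u v, K u -> K v -> K (a *: u + v);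
  right_idealM : forall x y, K x -> K (x * y)
}.

Record stable_ideal (K : set P) : Prop := StableIdeal {
  stable_right_ideal :> right_ideal K;
  stable_coact_conv : forall g x, K x -> K (coact_conv g x)
}.

Lemma right_idealD K u v : right_ideal K -> K u -> K v -> K (u + v).
Proof. by move=> rK Ku Kv; rewrite -[u]scale1r; apply: right_idealP. Qed.

Lemma stable_ker (Q : comodAlgType H) (f : comod_alg_hom P Q) :
  stable_ideal (ker f).
Proof.
split; first split; rewrite /ker /=.
- exact: linear0.
- by move=> a u v fu fv; rewrite linearP fu fv scaler0 addr0.
- by move=> x y fx; rewrite (alg_homM f) fx mul0r.
by move=> g x fx; rewrite coact_conv_hom fx !linear0.
Qed.

Lemma stable_add I J : stable_ideal I -> stable_ideal J ->
  stable_ideal (ideal_add I J).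
Proof.
move=> sI sJ; split; first split.
- exists 0; first exact: right_ideal0 sI.
  by exists 0; [exact: right_ideal0 sJ|rewrite addr0].
- move=> a _ _ [y Iy [z Jz ->]] [y' Iy' [z' Jz' ->]].
  exists (a *: y + y'); first exact: (right_idealP sI).
  exists (a *: z + z'); first exact: (right_idealP sJ).
  by rewrite scalerDr addrACA.
- move=> _ x [y Iy [z Jz ->]]; exists (y * x); first exact: (right_idealM sI).
  by exists (z * x); [exact: (right_idealM sJ)|rewrite mulrDl].
move=> g _ [y Iy [z Jz ->]]; exists (coact_conv g y).
  exact: stable_coact_conv.
by exists (coact_conv g z); [exact: stable_coact_conv|rewrite linearD].
Qed.

Lemma stable_bigcap (T : Type) (K : T -> set P) :
  (forall i, stable_ideal (K i)) -> stable_ideal (\bigcap_i K i)%classic.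
Proof.
move=> sK; split; first split.
- by move=> i _; apply: (right_ideal0 (sK i)).
- by move=> a u v Ku Kv i Ti; apply: (right_idealP (sK i)); [apply: Ku|apply: Kv].
- by move=> x y Kx i Ti; apply: (right_idealM (sK i)); apply: Kx.
by move=> g x Kx i Ti; apply: (stable_coact_conv (sK i)); apply: Kx.
Qed.

Lemma stable_cap I J : stable_ideal I -> stable_ideal J ->
  stable_ideal (I `&` J)%classic.
Proof.
move=> sI sJ; split; first split.
- by split; [apply: (right_ideal0 sI)|apply: (right_ideal0 sJ)].
- move=> a u v [Iu Ju] [Iv Jv].
  by split; [apply: (right_idealP sI)|apply: (right_idealP sJ)].
- by move=> x y [Ix Jx]; split; [apply: (right_idealM sI)|apply: (right_idealM sJ)].
by move=> g x [Ix Jx]; split; apply: stable_coact_conv.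
Qed.

(** Slicing away the B-leg commutes with the coaction on the P-leg. *)
Lemma slice_swap_coact (t : B ** P) (phi : {linear B -> k^o}) :
  tassoc (t *t (1 : H)) = tmap idfun coact t ->
  slice phi (tswap t) \in coinvs.
Proof.
move=> tco; apply/coinvP.
pose slicel (V : lmodType k) (u : B ** V) := slice phi (tswap u).
have -> : coact (slice phi (tswap t)) = slicel _ (tmap idfun coact t).
  rewrite /slicel; elim/tensor_ind: t {tco} => [|b p t IH].
    by rewrite tmap0 !tswap0 !slice0 linear0.
  by rewrite tmapD tmapE !tswapD !sliceD linearD IH !tswapE !sliceE linearZ.
rewrite -tco /slicel /tassoc; elim/tensor_ind: t {tco} => [|b p t IH].
  by rewrite !linear0l tlift0 !tswap0 !slice0 linear0l.
rewrite tensDl tliftD !tswapD !sliceD tensDl -IH -/(tassoc _) tassocE.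
by rewrite !tswapE !sliceE tensZl.
Qed.

(* The splitting s of an invariant element takes values in B (x) B, so a      *)
(* linear retraction of P onto B, applied to the second leg, is harmless.     *)
Lemma principal_total_integral : principal P ->
  exists2 g : {linear H -> P}, g 1 = 1 & forall p, coact_conv g p \in coinvs.
Proof.
move=> [canB [s [s_mul sB sco]]].
have [b|r rK _] := @linear_retraction k B P val set0.
  by move=> b0; apply: val_inj; elim: b0 => // a x v [].
have [g gE] := @stwist_coact k H P s (val \o r) sB canB.
have gB p : coact_conv g p \in coinvs.
  rewrite /coact_conv -gE /stwist.
  suff -> : tmult (tmap val (val \o r) (s p)) = val (tmult (tmap idfun r (s p))).
    exact: coinv_valP.
  rewrite /tmult; elim/tensor_ind: (s p) => [|b q t IH].
    by rewrite !(tmap0, tlift0).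
  by rewrite !tmapD !tliftD IH !tmapE !tliftE.
(* Since 1 is invariant, g(1) is the value of the map at 1, namely the sum of the b r(q) over [s 1].
   Each q can be taken in B, where r is the identity, so the sum is the product of the legs of
   [s 1], which is 1. *)
exists g => //; have c1 : 1 \in coinvs by apply: rpred1.
rewrite -[g 1]mul1r -(coact_conv_coinv _ c1) /coact_conv -gE /stwist.
rewrite -[RHS](s_mul 1) -[s 1]tswapK.
have := @slices_tens _ P B (fun p => p \in coinvs) (tswap (s 1)).
elim=> [|a _ v [p pB [b ->]] _ IH|||phi].
- by rewrite /tmult /bact !(tswap0, tmap0, tlift0).
- rewrite -tensZl; have -> : a *: p = val (a *: Coinv pB) by [].
  move: (a *: _) IH => c; rewrite /tmult /bact => IH.
  rewrite tswapD tswapE tmapD !tliftD IH tmapE !tliftE /=.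
  by rewrite rK.
- by case: (coinv_submod P).
- have [_ lc] := coinv_submod P => a u v cu cv; exact: (lc a u v cu cv).
- by apply: slice_swap_coact; rewrite -sco (coinvP _ c1) tmapE.
Qed.

(** For p in [K], the slices of [s p] lie in both [K] and B, hence in [M]. So [s p] is a sum of b
    (x) q with b in [M], and multiplying out gives p in [M]. *)
Lemma stable_subset K M : principal P -> stable_ideal K -> right_ideal M ->
  (forall b : B, K (val b) -> M (val b)) -> (K `<=` M)%classic.
Proof.
move=> [canB [s [s_mul sB _]]] sK rM KM p Kp.
have sl (phi : {linear P -> k^o}) : M (val (slice phi (s p))).
  (* With f = phi(.) 1, the product b f(q) is phi(q) b, so the twist by f is exactly the slice along
     phi. *)
  apply: KM; pose f0 (x : P) : P := (phi x : k) *: (1 : P).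
  have flin : linear f0.
    by move=> a u v; rewrite /f0 linearP; apply: (tscalel_bilinear P).1.
  pose f := HB.pack_for {linear P -> P} f0 (GRing.isLinear.Build k P P *:%R f0 flin).
  have [g gE] := @stwist_coact k H P s f sB canB.
  suff -> : val (slice phi (s p)) = coact_conv g p by apply: stable_coact_conv.
  rewrite /coact_conv -gE /stwist.
  rewrite /tmult; elim/tensor_ind: (s p) => [|b q t IH].
    by rewrite slice0 tmap0 tlift0.
  rewrite tmapD sliceD tliftD tmapE tliftE sliceE linearD linearZ /= IH /mull /f0.
  by rewrite -pz_scalerAr mulr1.
rewrite -(s_mul p).
have := @slices_tens _ B P (fun b => M (val b)) (s p).
elim=> [|a _ v [b Mb [q ->]] _ IH|||//].
- rewrite /bact tlift0; exact: right_ideal0 rM.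
- rewrite /bact linearP; apply: (right_idealP rM) => //.
  by rewrite /= tliftE; apply: (right_idealM rM).
- exact: right_ideal0 rM.
- by move=> a u v; apply: (right_idealP rM).
Qed.

End StableIdeals.

(** * Comparison of the lattices in P and in B *)

Section CoveringLattice.
Variables (k : fieldType) (H : hopfAlgType k) (N : nat) (P : comodAlgType H).
Variables (P_ : 'I_N -> comodAlgType H) (pi : forall i, comod_alg_hom P (P_ i)).
Hypothesis prP : principal P.
Local Notation B := (coinv P).
Local Notation kerP := (fun i => ker (pi i)).
Local Notation kerB := (fun i => ker (coinv_hom (pi i))).

Definition contract (K : set P) : set B := [set b | K (val b)]%classic.

Lemma contract_ker (Q : comodAlgType H) (f : comod_alg_hom P Q) :
  contract (ker f) = ker (coinv_hom f).
Proof.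
apply/seteqP; split=> b; rewrite /contract /ker /= => fb.
  exact: val_inj.
by rewrite -[LHS]/(val (coinv_fun f b)) fb.
Qed.

Lemma lattice_stable K : ideal_lattice kerP K -> stable_ideal K.
Proof.
by elim=> [i|I J _ sI _ sJ|I J _ sI _ sJ];
  [exact: stable_ker|exact: stable_add|exact: stable_cap].
Qed.

(** If b = x + y, the projection onto B fixes b and sends x and y to invariant elements of the same
    ideals. *)
Lemma contract_add I J : stable_ideal I -> stable_ideal J ->
  contract (ideal_add I J) = ideal_add (contract I) (contract J).
Proof.
move=> sI sJ; have [g g1 gB] := principal_total_integral prP.
apply/seteqP; split=> b; last first.
  by case=> c Ic [d Jd ->]; exists (val c) => //; exists (val d).
case=> x Ix [y Jy bE].
exists (Coinv (gB x)); first exact: stable_coact_conv.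
exists (Coinv (gB y)); first exact: stable_coact_conv.
apply: val_inj; rewrite /= -linearD /= -bE coact_conv_coinv; last exact: coinv_valP.
by rewrite g1 mulr1.
Qed.

Lemma lattice_contract K : ideal_lattice kerP K -> ideal_lattice kerB (contract K).
Proof.
elim=> [i|I J LI IHI LJ IHJ|I J LI IHI LJ IHJ].
- by rewrite contract_ker; apply: ideal_lattice_gen.
- by rewrite contract_add; [apply: ideal_lattice_add|exact: lattice_stable..].
- exact: ideal_lattice_cap.
Qed.

Lemma lattice_contract_surj L : ideal_lattice kerB L ->
  exists2 K, ideal_lattice kerP K & L = contract K.
Proof.
elim=> [i|_ _ _ [I LI ->] _ [J LJ ->]|_ _ _ [I LI ->] _ [J LJ ->]].
- by exists (ker (pi i)); [exact: ideal_lattice_gen|rewrite contract_ker].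
- exists (ideal_add I J); first exact: ideal_lattice_add.
  by rewrite contract_add //; exact: lattice_stable.
- by exists (I `&` J)%classic; first exact: ideal_lattice_cap.
Qed.

(** Projecting any preimage x of c into B still gives a preimage: its image is c_(0) f(g(c_(1))) = c
    f(g(1)) = c. *)
Lemma coinv_hom_surj (Q : comodAlgType H) (f : comod_alg_hom P Q) :
  (forall y, exists x, f x = y) -> forall c, exists b, coinv_hom f b = c.
Proof.
move=> f_surj c; have [g g1 gB] := principal_total_integral prP.
have [x fx] := f_surj (val c); exists (Coinv (gB x)); apply: val_inj => /=.
rewrite coact_conv_hom fx (eqP (coinv_valP c)) tmapE tmultE /= g1 (alg_hom1 f).
exact: mulr1.
Qed.

Lemma distributive_contract :
  distributive_lattice (ideal_lattice kerP) <->
  distributive_lattice (ideal_lattice kerB).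
Proof.
split=> distr I J K.
  move=> /lattice_contract_surj[{}I LI ->] /lattice_contract_surj[{}J LJ ->].
  move=> /lattice_contract_surj[{}K LK ->].
  have [sI sJ sK] := And3 (lattice_stable LI) (lattice_stable LJ) (lattice_stable LK).
  rewrite -contract_add // -[LHS]/(contract (I `&` ideal_add J K)%classic) distr //.
  by rewrite contract_add //; apply: stable_cap.
move=> LI LJ LK.
have [sI sJ sK] := And3 (lattice_stable LI) (lattice_stable LJ) (lattice_stable LK).
have [sIJ sIK] := conj (stable_cap sI sJ) (stable_cap sI sK).
(* One inclusion holds in any lattice of ideals. The other is tested on B, where the hypothesis
   applies. *)
apply/seteqP; split=> [|_ [y [Iy Jy] [z [Iz Kz] ->]]]; last first.
  by split; [exact: (right_idealD sI)|exists y => //; exists z].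
apply: stable_subset => //; first exact/stable_cap/stable_add.
  exact: stable_add.
suff /seteqP[] : contract (I `&` ideal_add J K)%classic =
    contract (ideal_add (I `&` J) (I `&` K))%classic by [].
rewrite [RHS]contract_add //.
rewrite -[LHS]/(contract I `&` contract (ideal_add J K))%classic contract_add //.
by apply: distr; apply: lattice_contract.
Qed.

Lemma bigcap_ker_contract :
  (\bigcap_i ker (pi i) = [set 0])%classic <->
  (\bigcap_i ker (coinv_hom (pi i)) = [set 0])%classic.
Proof.
split=> /seteqP[cap0 _]; apply/seteqP; split=> [|_ -> i _]; try exact: linear0.
  move=> b bK; apply: val_inj; apply: cap0 => i _.
  by have := bK i I; rewrite -contract_ker.
(* The intersection of the kernels is compared with the zero right ideal. *)
apply: stable_subset => //.
- by apply: stable_bigcap => i; apply: stable_ker.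
- split=> //= [a _ _ -> ->|_ y ->]; first by rewrite scaler0 addr0.
  by rewrite mul0r.
move=> b bK; suff -> : b = 0 by [].
by apply: cap0 => i _; rewrite -contract_ker; apply: bK.
Qed.

End CoveringLattice.

Theorem corollary3p8 (k : fieldType) (H : hopfAlgType k)
    (N : nat) (P : comodAlgType H) (P_ : 'I_N -> comodAlgType H)
    (pi : forall i, comod_alg_hom P (P_ i)) :
  bijective (antipode : H -> H) ->
  (0 < N)%N ->
  (forall i (y : P_ i), exists x : P, pi i x = y) ->
  principal P ->
  covering (fun i => comod_alg_hom_alg (pi i)) <->
  covering (fun i => coinv_hom (pi i)).
Proof.
move=> _ _ pi_surj prP; split=> -[_ cap0 distr]; split=> //.
- by move=> i; apply: coinv_hom_surj.
- exact/(bigcap_ker_contract pi prP).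
- exact/(distributive_contract pi prP).
- exact/(bigcap_ker_contract pi prP).
- exact/(distributive_contract pi prP).
Qed.
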